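(* For any $\eta>k^2$, $\lambda=1$ is an eigenvalue of the preconditioned matrix $\mathcal{P}^{-1}\mathcal{K}$ with algebraic multiplicity $2m$. The rest of the eigenvalues $\lambda$ are bounded by $$\frac{\bar\alpha-k^2}{\bar\alpha+\eta-k^2}<\lambda<1 .$$
   Context: Let $m\le n$ and let $k$, $\eta$ be real numbers. The matrices below arise from an edge element discretization of the time-harmonic Maxwell equations with wave number $k$ in saddle-point form. $A\in\mathbb{R}^{n\times n}$ is symmetric positive semidefinite with $\dim\ker(A)=m$; $M\in\mathbb{R}^{n\times n}$ is symmetric positive definite; $B\in\mathbb{R}^{m\times n}$ has full row rank; $C\in\mathbb{R}^{n\times m}$ is a matrix whose columns span $\ker(A)$ (so $AC=0$) and which satisfies $MC=B^T$; and $L=BC\in\mathbb{R}^{m\times m}$ is the discrete Laplacian (so $L=C^TMC$ is symmetric positive definite). Then $\mathbb{R}^n=\ker(A)\oplus\ker(B)$. The saddle-point matrix is $\mathcal{K}=\begin{pmatrix} A-k^2M & B^T\\ B & 0\end{pmatrix}$, and both $\mathcal{K}$ and $A-k^2M$ are assumed nonsingular. $\bar\alpha>0$ is a constant, independent of the mesh size, such that $u^TAu\ge\bar\alpha\,u^TMu$ for all $u\in\ker(B)$. For $\eta>k^2$ the preconditioner $\mathcal{P}$ is defined through its inverse $$\mathcal{P}^{-1}=\begin{pmatrix}(A+\eta M-k^2M)^{-1}(I-B^TL^{-1}C^T) & CL^{-1}\\ L^{-1}C^T & k^2L^{-1}\end{pmatrix}.$$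
   Formalization: The strict lower bound fails when the coercivity inequality is attained; the formal theorem proves it with ≤ in general, and with < when u^T A u > ᾱ u^T M u for all nonzero u in ker(B). That 1 is an eigenvalue is asserted for m > 0. *)

(* Defs.v *)
From mathcomp Require Import all_boot all_order all_algebra.
From mathcomp Require Import reals.
From mathcomp Require Export complex.

Set Implicit Arguments.
Unset Strict Implicit.
Unset Printing Implicit Defensive.

Import Order.TTheory GRing.Theory Num.Theory.
Local Open Scope ring_scope.

Definition qform (R : realType) (n : nat) (A : 'M[R]_n) (u : 'cV[R]_n) : R :=
  (u^T *m A *m u) 0 0.

Definition sym_posdef (R : realType) (n : nat) (A : 'M[R]_n) : Prop :=
  A^T = A /\ forall u : 'cV[R]_n, u != 0 -> 0 < qform A u.

Definition sym_possemidef (R : realType) (n : nat) (A : 'M[R]_n) : Prop :=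
  A^T = A /\ forall u : 'cV[R]_n, 0 <= qform A u.

(* kermx is the kernel of the action on row vectors. Hence, the rows of
   rker A are a spanning family, transposed, of {u | A *m u = 0}. *)
Definition rker (R : realType) (p n : nat) (A : 'M[R]_(p, n)) : 'M[R]_n :=
  kermx A^T.

Definition discrete_laplacian (R : realType) (m n : nat)
  (B : 'M[R]_(m, n)) (C : 'M[R]_(n, m)) : 'M[R]_m := B *m C.

Definition saddle_mx (R : realType) (m n : nat) (k : R) (A M : 'M[R]_n)
  (B : 'M[R]_(m, n)) : 'M[R]_(n + m) :=
  block_mx (A - k ^+ 2 *: M) B^T B 0.

(* The matrix written P^-1: the preconditioner is defined through it. *)
Definition precond_inv (R : realType) (m n : nat) (k eta : R) (A M : 'M[R]_n)
  (B : 'M[R]_(m, n)) (C : 'M[R]_(n, m)) : 'M[R]_(n + m) :=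
  let Li := invmx (discrete_laplacian B C) in
  block_mx
    (invmx (A + eta *: M - k ^+ 2 *: M) *m (1%:M - B^T *m Li *m C^T)) (C *m Li)
    (Li *m C^T)                                       (k ^+ 2 *: Li).

(* The preconditioned matrix is real but not symmetric, so it is viewed as a
   complex matrix: its spectrum consists of all complex eigenvalues. *)
Definition precond_mx (R : realType) (m n : nat) (k eta : R) (A M : 'M[R]_n)
  (B : 'M[R]_(m, n)) (C : 'M[R]_(n, m)) : 'M[R[i]]_(n + m) :=
  map_mx (real_complex R) (precond_inv k eta A M B C *m saddle_mx k A M B).

Definition alg_mult (F : fieldType) (n : nat) (A : 'M[F]_n) (a : F) : nat :=
  mup a (char_poly A).

(* Main.v *)
(** Write [H = A + eta M - k^2 M] and [S = A - k^2 M + eta B^T L^-1 B]. Since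
    [A C = 0] and [M C = B^T], the preconditioned matrix is block diagonal with
    blocks [T = H^-1 S] and the identity. Moreover [B T = B] and [T C = C], so
    in a row basis made of the rows of [B] and a basis of the left kernel of
    [C], the matrix [T] becomes block diagonal with blocks the identity and
    some [D]. A row [w] with [w C = 0] has the form [z H] with [z B^T = 0]; on
    such [z] the pencil [S - H] acts as [- eta M], so 1 is not an eigenvalue of
    [D]. Any other eigenvalue belongs to the symmetric definite pencil
    [(A - k^2 M, H)] restricted to [ker B], hence is the real Rayleigh quotient
    [(a - k^2 b) / (a + (eta - k^2) b)] with [a >= alpha b > 0]. *)
Require Import Defs.
From mathcomp Require Import all_boot all_order all_algebra.
From mathcomp Require Import reals complex.
From mathcomp Require Import ring lra.

Import Order.TTheory GRing.Theory Num.Theory.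
Local Open Scope ring_scope.

(** * Characteristic polynomials and root multiplicities *)

(** Taking determinants in [P (X - A) = (X - B) P] lets the nonzero constant [det P] cancel. The
    sizes [p] and [n] stay separate because the basis used later is a stack of two row blocks. *)
Lemma char_poly_conj (F : fieldType) (p n : nat) (P : 'M[F]_(p, n))
    (A : 'M_n) (B : 'M_p) :
  p = n -> row_free P -> P *m A = B *m P -> char_poly A = char_poly B.
Proof.
move=> epn; move: P B; rewrite {p}epn => P B.
rewrite row_free_unit => Pu PA.
set Q := map_mx (@polyC F) P.
have e : Q *m char_poly_mx A = char_poly_mx B *m Q.
  rewrite /char_poly_mx mulmxBr mulmxBl -!map_mxM PA.
  by rewrite -scalar_mxC.
have := congr1 determinant e; rewrite !det_mulmx mulrC => /mulIf; apply.
by rewrite det_map_mx polyC_eq0 -unitfE -unitmxE.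
Qed.

Lemma char_poly_scalar (F : fieldType) (n : nat) (a : F) :
  char_poly (a%:M : 'M_n) = ('X - a%:P) ^+ n.
Proof.
by rewrite /char_poly /char_poly_mx map_scalar_mx -raddfB det_scalar.
Qed.

Lemma char_poly_block_diag (F : fieldType) (m n : nat)
    (A : 'M[F]_m) (B : 'M[F]_n) :
  char_poly (block_mx A 0 0 B) = char_poly A * char_poly B.
Proof. by rewrite /char_poly char_block_diag_mx det_ublock. Qed.

(** A field morphism preserves and reflects divisibility by powers of [X - a]; this carries
    multiplicities from the reals to the complex numbers. *)
Lemma mup_map_poly (F K : fieldType) (f : {rmorphism F -> K}) (p : {poly F})
    (a : F) :
  p != 0 -> mup (f a) (map_poly f p) = mup a p.
Proof.
move=> p0.
have fp0 : map_poly f p != 0 by rewrite map_poly_eq0.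
have e d : (d <= mup (f a) (map_poly f p))%N = (d <= mup a p)%N.
  by rewrite !mup_geq // -map_polyXsubC -rmorphXn dvdp_map.
by apply/eqP; rewrite eqn_leq e -e !leqnn.
Qed.

(** * Real and imaginary parts of complex rows times real matrices *)

Lemma map_Re_mulmx (R : realType) (m n p : nat) (W : 'M[R[i]]_(m, n))
    (T : 'M[R]_(n, p)) :
  map_mx (@complex.Re R) (W *m map_mx (real_complex R) T) =
  map_mx (@complex.Re R) W *m T.
Proof.
apply/matrixP => i j; rewrite !mxE (big_morph _ (id1 := 0) (op1 := +%R)) //.
  by apply: eq_bigr => l _; rewrite !mxE; case: (W i l) => a b /=; ring.
by case=> a b [c d].
Qed.

Lemma map_Im_mulmx (R : realType) (m n p : nat) (W : 'M[R[i]]_(m, n))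
    (T : 'M[R]_(n, p)) :
  map_mx (@complex.Im R) (W *m map_mx (real_complex R) T) =
  map_mx (@complex.Im R) W *m T.
Proof.
apply/matrixP => i j; rewrite !mxE (big_morph _ (id1 := 0) (op1 := +%R)) //.
  by apply: eq_bigr => l _; rewrite !mxE; case: (W i l) => a b /=; ring.
by case=> a b [c d].
Qed.

(** * Quadratic forms and symmetric definite pencils *)

Lemma sym_posdef_unitmx (R : realType) (n : nat) (H : 'M[R]_n) :
  sym_posdef H -> H \in unitmx.
Proof.
move=> [_ Hpos]; rewrite -row_free_unit; apply: inj_row_free => v vH.
apply/eqP/negPn/negP => v0.
have := Hpos v^T; rewrite trmx_eq0 => /(_ v0).
by rewrite /qform trmxK vH mul0mx mxE ltxx.
Qed.

Lemma qform_ge0 (R : realType) (n : nat) (M : 'M[R]_n) (u : 'cV_n) :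
  sym_posdef M -> 0 <= qform M u.
Proof.
move=> [_ Mpos]; have [->|/Mpos/ltW//] := eqVneq u 0.
by rewrite /qform mulmx0 mxE.
Qed.

Lemma qformD (R : realType) (n : nat) (A B : 'M[R]_n) (u : 'cV_n) :
  qform (A + B) u = qform A u + qform B u.
Proof. by rewrite /qform mulmxDr mulmxDl mxE. Qed.

Lemma qformZ (R : realType) (n : nat) (a : R) (A : 'M[R]_n) (u : 'cV_n) :
  qform (a *: A) u = a * qform A u.
Proof. by rewrite /qform -scalemxAr -scalemxAl mxE. Qed.

Lemma qformN (R : realType) (n : nat) (A : 'M[R]_n) (u : 'cV_n) :
  qform (- A) u = - qform A u.
Proof. by rewrite /qform mulmxN mulNmx mxE. Qed.

(* Real form of [(x + i y) S = (p + i q) (x + i y) H]. *)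
Lemma sym_pencil_eigenvalue_real (R : realType) (n : nat) (S H : 'M[R]_n)
    (p q : R) (x y : 'rV_n) :
  S^T = S -> sym_posdef H -> (x != 0) || (y != 0) ->
  x *m S = p *: (x *m H) - q *: (y *m H) ->
  y *m S = q *: (x *m H) + p *: (y *m H) ->
  q = 0 /\ qform S x^T + qform S y^T = p * (qform H x^T + qform H y^T).
Proof.
move=> Ssym hH xy0 xS yS.
have sw (G : 'M[R]_n) : G^T = G ->
    (y *m G *m x^T) 0 0 = (x *m G *m y^T) 0 0.
  move=> eG; transitivity ((x *m G *m y^T)^T 0 0); last by rewrite mxE.
  by rewrite !trmx_mul trmxK eG mulmxA.
have Hsum : 0 < qform H x^T + qform H y^T.
  case/orP: xy0 => [x0|y0].
    by rewrite ltr_wpDr ?qform_ge0 //; apply: hH.2; rewrite trmx_eq0.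
  by rewrite ltr_wpDl ?qform_ge0 //; apply: hH.2; rewrite trmx_eq0.
have entry (u v w : 'rV[R]_n) (a b : R) : u *m S = a *: (v *m H) + b *: (w *m H) ->
    forall z : 'rV_n, (u *m S *m z^T) 0 0 =
      a * (v *m H *m z^T) 0 0 + b * (w *m H *m z^T) 0 0.
  by move=> -> z; rewrite mulmxDl -!scalemxAl !mxE.
have {}xS := entry _ _ _ _ _ (etrans xS (congr1 _ (esym (scaleNr _ _)))).
have {}yS := entry _ _ _ _ _ yS.
(* Equating [y S x^T] with [x S y^T] cancels the [p] terms and leaves [q] times a positive
   number. *)
have := sw S Ssym; rewrite xS yS (sw H hH.1) => eq.
have q0 : q * (qform H x^T + qform H y^T) = 0.
  by rewrite /qform !trmxK; lra.
have {}q0 : q = 0 by move/eqP: q0; rewrite mulf_eq0 (gt_eqF Hsum) orbF => /eqP.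
split=> //; rewrite /qform !trmxK xS yS q0; ring.
Qed.

(** * Block structure of the preconditioned matrix *)

Section Preconditioner.

Variables (R : realType) (m n : nat) (k eta : R).
Variables (A M : 'M[R]_n) (B : 'M[R]_(m, n)) (C : 'M[R]_(n, m)).

Let L := discrete_laplacian B C.
Let H := A + eta *: M - k ^+ 2 *: M.
Let S := A - k ^+ 2 *: M + eta *: (B^T *m invmx L *m B).
Let T := invmx H *m S.

Hypotheses (Asym : A^T = A) (Mpos : sym_posdef M) (AC : A *m C = 0).
Hypotheses (MC : M *m C = B^T) (Lu : L \in unitmx) (Hpos : sym_posdef H).
Hypothesis (heta : k ^+ 2 < eta).

Let Hu : H \in unitmx.
Proof. exact: sym_posdef_unitmx. Qed.

Let eta_k : eta - k ^+ 2 != 0.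
Proof. by rewrite gt_eqF // subr_gt0. Qed.

Let CM : C^T *m M = B.
Proof. by rewrite -[LHS]trmxK trmx_mul trmxK Mpos.1 MC trmxK. Qed.

Let CA : C^T *m A = 0.
Proof. by rewrite -[LHS]trmxK trmx_mul trmxK Asym AC trmx0. Qed.

Let Lsym : L^T = L.
Proof. by rewrite /L /discrete_laplacian trmx_mul -MC mulmxA CM. Qed.

Let CBt : C^T *m B^T = L.
Proof. by rewrite -trmx_mul Lsym. Qed.

Let HC : H *m C = (eta - k ^+ 2) *: B^T.
Proof. by rewrite /H mulmxBl mulmxDl AC add0r -!scalemxAl MC scalerBl. Qed.

Let CH : C^T *m H = (eta - k ^+ 2) *: B.
Proof. by rewrite /H mulmxBr mulmxDr CA add0r -!scalemxAr CM scalerBl. Qed.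

Let SC : S *m C = H *m C.
Proof.
rewrite HC /S mulmxDl mulmxBl AC -!scalemxAl MC -!mulmxA -/(discrete_laplacian B C).
by rewrite mulVmx // mulmx1 scalerBl addrC sub0r.
Qed.

Let CS : C^T *m S = C^T *m H.
Proof.
rewrite CH /S mulmxDr mulmxBr CA -!scalemxAr CM !mulmxA CBt mulmxV // mul1mx.
by rewrite scalerBl addrC sub0r.
Qed.

(** The upper right block vanishes because [C^T B^T = L], the lower left one because
    [C^T (A - k^2 M) = - k^2 B]. *)
Lemma precond_inv_mul_saddle :
  precond_inv k eta A M B C *m saddle_mx k A M B = block_mx T 0 0 1%:M.
Proof.
rewrite /precond_inv /saddle_mx -/L mulmx_block !mulmx0 !addr0.
have PiBt : (1%:M - B^T *m invmx L *m C^T) *m B^T = 0.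
  by rewrite mulmxBl mul1mx -!mulmxA CBt mulVmx // mulmx1 subrr.
have PiS : (1%:M - B^T *m invmx L *m C^T) *m (A - k ^+ 2 *: M) =
    A - k ^+ 2 *: M + k ^+ 2 *: (B^T *m invmx L *m B).
  rewrite mulmxBl mul1mx -!mulmxA mulmxBr CA sub0r -scalemxAr CM.
  by rewrite !mulmxN opprK -!scalemxAr.
rewrite -[_ *m (1%:M - _) *m (A - _)]mulmxA PiS.
rewrite -[_ *m (1%:M - _) *m B^T]mulmxA PiBt mulmx0.
rewrite -!mulmxA CBt mulVmx // mulmxBr CA sub0r -scalemxAr CM mulmxN.
rewrite -scalemxAr -scalemxAl addNr.
congr block_mx; apply: (canRL (mulKmx Hu)).
(* Here [H C = (eta - k^2) B^T] supplies the coefficient that completes [k^2] to the [eta] in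
   [S]. *)
rewrite mulmxDr mulKVmx // [H *m (C *m _)]mulmxA HC -scalemxAl.
by rewrite -addrA -scalerDl [k ^+ 2 + _]addrC subrK /S mulmxA.
Qed.

Lemma mulBT : B *m T = B.
Proof.
apply: (scalerI eta_k).
by rewrite scalemxAl -CH -mulmxA mulKVmx.
Qed.

Lemma mulTC : T *m C = C.
Proof. by rewrite /T -mulmxA SC mulKmx. Qed.

(** By [H C = (eta - k^2) B^T], the matrix [H^-1 B^T] is a multiple of [C]. *)
Lemma mulHinv_Bt p (w : 'M[R]_(p, n)) :
  w *m C = 0 -> w *m invmx H *m B^T = 0.
Proof.
move=> wC; apply: (scalerI eta_k).
by rewrite scaler0 scalemxAr -HC mulmxA mulmxKV.
Qed.

Let mulS_kerB p (z : 'M[R]_(p, n)) :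
  z *m B^T = 0 -> z *m S = z *m (A - k ^+ 2 *: M).
Proof.
by move=> zB; rewrite /S mulmxDr -scalemxAr !mulmxA zB !mul0mx scaler0 addr0.
Qed.

Lemma T_fixed_eq0 p (w : 'M[R]_(p, n)) : w *m C = 0 -> w *m T = w -> w = 0.
Proof.
move=> wC; have := mulHinv_Bt _ _ wC; rewrite /T mulmxA.
set z := w *m invmx H => zB zS.
have wz : w = z *m H by rewrite mulmxKV.
suff z0 : z = 0 by rewrite wz z0 mul0mx.
have eta0 : eta != 0 by rewrite gt_eqF // (le_lt_trans (sqr_ge0 k)).
have Mu := sym_posdef_unitmx _ _ _ Mpos.
rewrite -[z](mulmxK Mu) (_ : z *m M = 0) ?mul0mx //.
apply: (scalerI eta0); rewrite scaler0 scalemxAr.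
(* With [z B^T = 0], the equation [z S = z H] reduces to [eta z M = 0]. *)
move: zS; rewrite mulS_kerB // wz /H addrAC [in RHS]mulmxDr.
by move/eqP; rewrite -subr_eq0 opprD addNKr oppr_eq0 => /eqP.
Qed.

Lemma char_poly_T : exists r (D : 'M[R]_r),
  char_poly T = ('X - 1%:P) ^+ m * char_poly D /\ ~~ eigenvalue D 1.
Proof.
have rC : \rank C = m.
  apply/eqP; rewrite eqn_leq rank_leq_col -{1}(mxrank_unit Lu).
  exact: mxrankM_maxr.
set Y := row_base (kermx C).
have YC : Y *m C = 0 by apply/sub_kermxP; rewrite eq_row_base.
have Yfree : row_free Y := row_base_free _.
(* The left kernel of [C], spanned by the rows of [Y], is invariant because [T C = C]; [D] is the
   matrix of [T] on it. *)
set D := Y *m T *m pinvmx Y.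
have YT : Y *m T = D *m Y.
  rewrite mulmxKpV // eq_row_base; apply/sub_kermxP.
  by rewrite -mulmxA mulTC.
exists (\rank (kermx C)), D; split.
  rewrite -(char_poly_scalar R m 1) -char_poly_block_diag.
  apply: (char_poly_conj _ _ _ (col_mx B Y)).
  - by rewrite mxrank_ker rC subnKC // -rC rank_leq_row.
  - apply: inj_row_free => v; rewrite -[v]hsubmxK mul_row_col => e.
    (* Right multiplication by [C] kills the [Y] part and leaves [lsubmx v] times the invertible
       [L]. *)
    have v10 : lsubmx v = 0.
      apply: (can_inj (mulmxK Lu)); rewrite mul0mx -[RHS](mul0mx _ C) -e.
      by rewrite mulmxDl -(mulmxA _ Y) YC mulmx0 addr0 mulmxA.
    move: e; rewrite v10 mul0mx add0r => /eqP.
    by rewrite mulmx_free_eq0 // => /eqP->; rewrite row_mx0.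
  by rewrite mul_col_mx mulBT YT mul_block_col !mul0mx addr0 add0r mul1mx.
apply/negP => /eigenvalueP[v vD]; rewrite scale1r in vD; case/negP.
rewrite -(mulmx_free_eq0 _ Yfree); apply/eqP/T_fixed_eq0.
  by rewrite -mulmxA YC mulmx0.
by rewrite -mulmxA YT mulmxA vD.
Qed.

(** One [m] comes from the identity block, the other from the fixed rows of [B]; [D] contributes
    nothing. *)
Lemma alg_mult_precond : alg_mult (precond_mx k eta A M B C) 1 = (2 * m)%N.
Proof.
have [r [D [eT nD]]] := char_poly_T.
rewrite /alg_mult /precond_mx -map_char_poly -(rmorph1 (real_complex R)).
rewrite mup_map_poly ?monic_neq0 ?char_poly_monic //.
rewrite precond_inv_mul_saddle char_poly_block_diag eT char_poly_scalar.
rewrite mulrAC -exprD addnn -mul2n mupMl ?mup_XsubCX ?eqxx //.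
by rewrite -eigenvalue_root_char.
Qed.

(** * Eigenvalues different from 1 *)

(** The vectors [x] and [y] are the transposed real and imaginary parts of [w H^-1], with [w] the
    first block of a left eigenvector; the pair is needed since [lam] is not yet known to be
    real. *)
Lemma eigenvalue_precond (lam : R[i]) :
  eigenvalue (precond_mx k eta A M B C) lam -> lam != 1 ->
  complex.Im lam = 0 /\
  exists x y : 'cV[R]_n, [/\ B *m x = 0, B *m y = 0, (x != 0) || (y != 0) &
    qform (A - k ^+ 2 *: M) x + qform (A - k ^+ 2 *: M) y =
    complex.Re lam * (qform H x + qform H y)].
Proof.
case/eigenvalueP => v; rewrite /precond_mx precond_inv_mul_saddle.
rewrite map_block_mx !raddf0 map_mx1 -{1 2}[v]hsubmxK mul_row_block.
rewrite !mulmx0 addr0 add0r mulmx1 scale_row_mx => /eq_row_mx[].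
set w := lsubmx v => wT v2 v0 lam1.
have lam10 : 1 - lam != 0 by rewrite subr_eq0 eq_sym.
have rv0 : rsubmx v = 0.
  by apply: (scalerI lam10); rewrite scalerBl scale1r -v2 subrr scaler0.
have w0 : w != 0.
  by apply: contra_neq v0 => w0; rewrite -[v]hsubmxK -/w w0 rv0 row_mx0.
clearbody w.
(* Since [T C = C], the row [w C] equals [lam] times itself. *)
have wC : w *m map_mx (real_complex R) C = 0.
  apply: (scalerI lam10); rewrite scalerBl scale1r scaler0 scalemxAl -wT.
  by rewrite -mulmxA -map_mxM mulTC subrr.
pose z (f : R[i] -> R) := map_mx f w *m invmx H.
have wz f : map_mx f w = z f *m H by rewrite mulmxKV.
have zRB : z (@complex.Re R) *m B^T = 0.
  by apply: mulHinv_Bt; rewrite -map_Re_mulmx wC; apply/matrixP => i j; rewrite !mxE.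
have zIB : z (@complex.Im R) *m B^T = 0.
  by apply: mulHinv_Bt; rewrite -map_Im_mulmx wC; apply/matrixP => i j; rewrite !mxE.
have z0 : (z (@complex.Re R) != 0) || (z (@complex.Im R) != 0).
  rewrite -negb_and; apply: contra w0 => /andP[/eqP zR /eqP zI].
  have wR := wz (@complex.Re R); have wI := wz (@complex.Im R).
  rewrite zR mul0mx in wR; rewrite zI mul0mx in wI.
  apply/eqP/matrixP => i j; move/matrixP/(_ i j): wR; move/matrixP/(_ i j): wI.
  by rewrite !mxE; case: (w i j) => a b /= -> ->.
have Ssym : S^T = S.
  rewrite /S !(linearD, linearN, linearZ) /= Asym Mpos.1.
  by rewrite !trmx_mul trmxK trmx_inv Lsym mulmxA.
have [||q0 e] := sym_pencil_eigenvalue_real _ _ _ _ (complex.Re lam)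
    (complex.Im lam) _ _ Ssym Hpos z0.
- rewrite -!wz -mulmxA -/T -map_Re_mulmx wT.
  by apply/matrixP => i j; rewrite !mxE; case: (lam) (w i j) => a b [c d].
- rewrite -!wz -mulmxA -/T -map_Im_mulmx wT.
  by apply/matrixP => i j; rewrite !mxE; case: (lam) (w i j) => a b [c d] /=; ring.
split=> //; exists (z (@complex.Re R))^T, (z (@complex.Im R))^T.
split.
- by apply: trmx_inj; rewrite trmx_mul trmxK zRB trmx0.
- by apply: trmx_inj; rewrite trmx_mul trmxK zIB trmx0.
- by rewrite !trmx_eq0.
(* The [eta] term of [S] vanishes on the kernel of [B]. *)
by rewrite -e /qform !trmxK !mulS_kerB.
Qed.

End Preconditioner.

(** Equality in the coercivity estimate would give equality in the lower bound, so strictness there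
    is drawn from strict coercivity. For [m = 0] the multiplicity is zero, hence the condition on
    [m] in the first claim. *)
Theorem theorem3p5 (R : realType) (m n : nat) (k eta alpha : R)
  (A M : 'M[R]_n) (B : 'M[R]_(m, n)) (C : 'M[R]_(n, m))
  (hmn : (m <= n)%N)
  (hA : sym_possemidef A)
  (hkerA : \rank (rker A) = m)
  (hM : sym_posdef M)
  (hB : row_free B)
  (hC : (C^T == rker A)%MS)
  (hMC : M *m C = B^T)
  (hK : saddle_mx k A M B \in unitmx)
  (hAkM : A - k ^+ 2 *: M \in unitmx)
  (halpha : 0 < alpha)
  (hcoer : forall u : 'cV[R]_n, B *m u = 0 -> alpha * qform M u <= qform A u)
  (heta : k ^+ 2 < eta) :
  [/\ (0 < m)%N -> eigenvalue (precond_mx k eta A M B C) 1,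
      alg_mult (precond_mx k eta A M B C) 1 = (2 * m)%N,
      forall lam : R[i],
        eigenvalue (precond_mx k eta A M B C) lam -> lam != 1 ->
        complex.Im lam = 0 /\
        (alpha - k ^+ 2) / (alpha + eta - k ^+ 2) <= complex.Re lam < 1
    & (forall u : 'cV[R]_n, B *m u = 0 -> u != 0 ->
         alpha * qform M u < qform A u) ->
      forall lam : R[i],
        eigenvalue (precond_mx k eta A M B C) lam -> lam != 1 ->
        (alpha - k ^+ 2) / (alpha + eta - k ^+ 2) < complex.Re lam].

Proof.
have AC : A *m C = 0.
  apply: trmx_inj; rewrite trmx_mul trmx0; apply/sub_kermxP.
  by case/andP: hC.
have CMC : discrete_laplacian B C = C^T *m M *m C.
  by rewrite /discrete_laplacian -[B]trmxK -hMC trmx_mul hM.1.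
have Lu : discrete_laplacian B C \in unitmx.
  (* The [m] columns of [C] span a kernel of dimension [m], so [C] is injective. *)
  have CTfree : row_free C^T by rewrite /row_free (eqmx_rank hC) hkerA.
  apply: sym_posdef_unitmx; rewrite CMC; split=> [|u u0].
    by rewrite !trmx_mul trmxK hM.1 mulmxA.
  have -> : qform (C^T *m M *m C) u = qform M (C *m u).
    by rewrite /qform trmx_mul !mulmxA.
  apply: hM.2; rewrite -trmx_eq0 trmx_mul mulmx_free_eq0 //.
  by rewrite trmx_eq0.
have qH u : qform (A + eta *: M - k ^+ 2 *: M) u =
    qform A u + (eta - k ^+ 2) * qform M u.
  by rewrite !qformD qformN !qformZ; ring.
have Hpos : sym_posdef (A + eta *: M - k ^+ 2 *: M).
  split=> [|u u0]; first by rewrite !(linearD, linearN, linearZ) /= hA.1 hM.1.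
  by rewrite qH ltr_wpDl ?hA.2 // mulr_gt0 ?subr_gt0 ?hM.2.
have mult := alg_mult_precond _ _ _ _ _ _ _ _ _ hA.1 hM AC hMC Lu Hpos heta.
have eta0 : 0 < eta := le_lt_trans (sqr_ge0 k) heta.
have den0 : 0 < alpha + eta - k ^+ 2 by lra.
(* For an eigenvector [x + i y], [a] and [b] are the values of the A- and
   M-forms; the eigenvalue is [(a - k^2 b) / (a + (eta - k^2) b)]. *)
have key lam : eigenvalue (precond_mx k eta A M B C) lam -> lam != 1 ->
    complex.Im lam = 0 /\ exists x y : 'cV[R]_n, exists a b : R,
    [/\ B *m x = 0, B *m y = 0, (x != 0) || (y != 0) &
     [/\ a = qform A x + qform A y, b = qform M x + qform M y, 0 < b,
        0 < a + (eta - k ^+ 2) * b &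
        complex.Re lam = (a - k ^+ 2 * b) / (a + (eta - k ^+ 2) * b)]].
  move=> ev lam1.
  have [im0 [x [y [Bx By xy0 e]]]] :=
    eigenvalue_precond _ _ _ _ _ _ _ _ _ hA.1 hM AC hMC Lu Hpos heta _ ev lam1.
  split=> //; exists x, y, (qform A x + qform A y), (qform M x + qform M y).
  split=> //.
  have b0 : 0 < qform M x + qform M y.
    case/orP: xy0 => [x0|y0].
      by rewrite ltr_wpDr ?qform_ge0 // hM.2.
    by rewrite ltr_wpDl ?qform_ge0 // hM.2.
  have d0 : 0 < qform A x + qform A y + (eta - k ^+ 2) * (qform M x + qform M y).
    by rewrite ltr_wpDl ?addr_ge0 ?hA.2 // mulr_gt0 ?subr_gt0.
  split=> //; apply: (canRL (mulfK (lt0r_neq0 d0))).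
  move: e; rewrite !qH !qformD !qformN !qformZ => e.
  by transitivity (complex.Re lam * (qform A x + (eta - k ^+ 2) * qform M x +
    (qform A y + (eta - k ^+ 2) * qform M y))); [ring | rewrite -e; ring].
split=> [m0||lam ev lam1|strict lam ev lam1].
- rewrite eigenvalue_root_char; apply/negPn/negP => /mupNroot mult0.
  by move: mult; rewrite /alg_mult mult0 => /esym/eqP; rewrite muln_eq0 !eqn0Ngt m0.
- exact: mult.
- have [-> [x [y [a [b [Bx By xy0 [ea eb b0 d0 ->]]]]]]] := key _ ev lam1.
  have ab : alpha * b <= a by rewrite ea eb mulrDr lerD ?hcoer.
  (* With denominators cleared, the bounds read [eta (a - alpha b) >= 0] and [eta b > 0]. *)
  split=> //; rewrite ler_pdivrMr // mulrAC ler_pdivlMr // ltr_pdivrMr // mul1r.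
  have := mulr_gt0 eta0 b0.
  have : 0 <= eta * (a - alpha * b) by rewrite mulr_ge0 ?subr_ge0 // ltW.
  by move=> *; apply/andP; split; lra.
have [_ [x [y [a [b [Bx By xy0 [ea eb b0 d0 ->]]]]]]] := key _ ev lam1.
have ab : alpha * b < a.
  (* One of [x], [y] may vanish; strictness comes from the nonzero one. *)
  rewrite ea eb mulrDr; case/orP: xy0 => [x0|y0].
    by rewrite ltr_leD ?hcoer ?strict.
  by rewrite ler_ltD ?hcoer ?strict.
rewrite ltr_pdivrMr // mulrAC ltr_pdivlMr //.
have : 0 < eta * (a - alpha * b) by rewrite mulr_gt0 ?subr_gt0.
lra.
Qed.
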